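(* There exist a kernel $K\in C(\mathbb{R}^2;\mathbb{R}^2)$, a time $T>0$, and a time-dependent finite Borel measure $\omega=\omega(t)$, $t\in[0,T]$, on $\mathbb{R}^2$ such that the velocity $$u(t,x)\coloneqq\int_{\mathbb{R}^2}K(x-y)\,d\omega(t)(y)$$ is continuous and weakly divergence free on $[0,T]\times\mathbb{R}^2$, $\omega$ is weakly advected by $u$ on $[0,T]$, and $\dim_H\mathrm{supp}\,\omega(0)=0$ while $\dim_H\mathrm{supp}\,\omega(T)=1$.
   Context: Weak advection (2D): Let $T>0$ and $u\in C([0,T]\times\mathbb{R}^2;\mathbb{R}^2)$ be continuous and weakly divergence free. A family $\mu(t)$, $t\in[0,T]$, of locally finite Borel measures on $\mathbb{R}^2$ is weakly advected by $u$ on $[0,T]$ if for every $\phi\in C_c^\infty([0,T]\times\mathbb{R}^2)$ $$\int_0^T\!\!\int\partial_t\phi(t,x)\,d\mu(t)(x)\,dt-\int\phi(T,x)\,d\mu(T)(x)+\int\phi(0,x)\,d\mu(0)(x)+\int_0^T\!\!\int (u\cdot\nabla)\phi(t,x)\,d\mu(t)(x)\,dt=0.$$ $\dim_H$ denotes Hausdorff dimension. *)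

(* Defs.v *)
(* R^2 is modelled as R * R (product topology,
   product sigma-algebra = Borel sigma-algebra of R^2), and [0,T] x R^2 as
   R * (R * R). *)
From mathcomp Require Import all_boot all_order all_algebra.
From mathcomp Require Import all_classical all_reals all_analysis.
Import Order.TTheory GRing.Theory Num.Theory numFieldTopology.Exports numFieldNormedType.Exports.
Set Implicit Arguments. Unset Strict Implicit. Unset Printing Implicit Defensive.
Local Open Scope classical_set_scope.
Local Open Scope ring_scope.

Section Defs.
Variable R : realType.

Definition dist2 (p q : R * R) : R :=
  Num.sqrt ((p.1 - q.1) ^+ 2 + (p.2 - q.2) ^+ 2).

Definition diam2 (U : set (R * R)) : R :=
  sup [set dist2 pq.1 pq.2 | pq in U `*` U].

Definition hausdorff_content (s delta : R) (A : set (R * R)) : \bar R :=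
  ereal_inf [set (\sum_(i <oo) ((diam2 (U i)) `^ s)%:E)%E
            | U in [set U : nat -> set (R * R) |
                    A `<=` \bigcup_i U i /\
                    forall i p q, U i p -> U i q -> dist2 p q <= delta]].

Definition hausdorff_measure (s : R) (A : set (R * R)) : \bar R :=
  ereal_sup [set hausdorff_content s delta A | delta in [set delta : R | 0 < delta]].

Definition hausdorff_dim (A : set (R * R)) : \bar R :=
  ereal_inf [set s%:E | s in [set s : R | 0 < s /\ hausdorff_measure s A = 0%E]].

Definition msupport (mu : {measure set (R * R) -> \bar R}) : set (R * R) :=
  [set x : R * R | forall U : set (R * R), open U -> U x -> (0 < mu U)%E].

Definition slice2 (i : bool) (g : R * R -> R) (p : R * R) : R -> R :=
  if i then (fun s => g (s, p.2)) else (fun s => g (p.1, s)).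
Definition coord2 (i : bool) (p : R * R) : R := if i then p.1 else p.2.
Definition pd2 (i : bool) (g : R * R -> R) : R * R -> R :=
  fun p => derive1 (slice2 i g p) (coord2 i p).

Definition smooth2 (g : R * R -> R) : Prop :=
  forall l : seq bool, let h := foldr pd2 g l in
    continuous h /\ forall i p, derivable (slice2 i h p) (coord2 i p) 1.

Definition slice3 (i : option bool) (g : R * (R * R) -> R) (p : R * (R * R))
  : R -> R :=
  match i with
  | None => fun s => g (s, p.2)
  | Some true => fun s => g (p.1, (s, p.2.2))
  | Some false => fun s => g (p.1, (p.2.1, s))
  end.
Definition coord3 (i : option bool) (p : R * (R * R)) : R :=
  match i with None => p.1 | Some true => p.2.1 | Some false => p.2.2 end.
Definition pd3 (i : option bool) (g : R * (R * R) -> R) : R * (R * R) -> R :=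
  fun p => derive1 (slice3 i g p) (coord3 i p).
Definition smooth3 (g : R * (R * R) -> R) : Prop :=
  forall l : seq (option bool), let h := foldr pd3 g l in
    continuous h /\ forall i p, derivable (slice3 i h p) (coord3 i p) 1.

Definition test2 (psi : R * R -> R) : Prop :=
  smooth2 psi /\ compact (closure [set x | psi x != 0]).

(* C_c^infty([0,T] x R^2): restrictions of C_c^infty(R x R^2) functions;
   phi t x is phi(t,x) *)
Definition test3 (phi : R -> R * R -> R) : Prop :=
  let g := fun p : R * (R * R) => phi p.1 p.2 in
  smooth3 g /\ compact (closure [set p | g p != 0]).

Definition transport (v : R * R) (psi : R * R -> R) (x : R * R) : R :=
  v.1 * pd2 true psi x + v.2 * pd2 false psi x.

Definition leb2 := (@lebesgue_measure R \x @lebesgue_measure R)%E.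

Definition interval0T (T : R) : set R := [set t | 0 <= t <= T].

Definition weakly_div_free (T : R) (u : R -> R * R -> R * R) : Prop :=
  forall t, 0 <= t <= T -> forall psi, test2 psi ->
    leb2.-integrable setT (EFin \o (fun x => transport (u t x) psi x)) /\
    Rintegral leb2 setT (fun x => transport (u t x) psi x) = 0.

Definition weakly_advected (T : R) (u : R -> R * R -> R * R)
    (mu : R -> {measure set (R * R) -> \bar R}) : Prop :=
  forall phi, test3 phi ->
    let dtphi := fun t x => derive1 (fun s => phi s x) t in
    let A := fun t => Rintegral (mu t) setT (dtphi t) in
    let B := fun t => Rintegral (mu t) setT
                        (fun x => transport (u t x) (phi t) x) in
    (forall t, 0 <= t <= T ->
       (mu t).-integrable setT (EFin \o dtphi t) /\
       (mu t).-integrable setT (EFin \o (fun x => transport (u t x) (phi t) x))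
       /\ (mu t).-integrable setT (EFin \o phi t)) /\
    lebesgue_measure.-integrable (interval0T T) (EFin \o A) /\
    lebesgue_measure.-integrable (interval0T T) (EFin \o B) /\
    Rintegral lebesgue_measure (interval0T T) A
      - Rintegral (mu T) setT (phi T)
      + Rintegral (mu 0) setT (phi 0)
      + Rintegral lebesgue_measure (interval0T T) B = 0.

Definition velocity (K : R * R -> R * R)
    (omega : R -> {measure set (R * R) -> \bar R}) (t : R) (x : R * R) : R * R :=
  (Rintegral (omega t) setT (fun y => (K (x.1 - y.1, x.2 - y.2)).1),
   Rintegral (omega t) setT (fun y => (K (x.1 - y.1, x.2 - y.2)).2)).

End Defs.

(* Main.v *)
(* The measure omega(t) is a sum of moving atoms.  Write a natural number n in
   binary with digits b_i and put
     x_n = sum_i b_i 2^-(i+1)^2,     y_n = sum_i b_i 2^-(i+1).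
   The closure of {x_n} is a Cantor set of dimension 0 (2^m pieces of size
   about 2^-(m+1)^2), whereas {y_n} is dense in [0,1], so that the closure of
   {(x_n, y_n)} has dimension 1: it is covered by 2^m pieces of size about
   2^-m, and its projection on the second axis is [0,1].  An atom of omega(t)
   of mass 2^-(n+1) sits at (x_n, t y_n), and an atom of mass 1 rests at
   (-2, 0).

   The kernel is K(z) = (0, k(z_1)), hence u(t,x) = (0, U(x_1)) is a shear
   flow, divergence free and constant in time.  As k vanishes on ]-oo, 1], the
   atoms at x_n do not interact with each other and do not move the atom at
   -2; the latter moves them with velocity k(x_n + 2) = y_n.  Such a continuous
   k exists: if tau is a continuous 2-periodic function equal to 0 on [0, 1/4]
   and to 1 on [1, 5/4], then x |-> sum_i tau(2^((i+1)^2) x) 2^-(i+1) maps x_n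
   to y_n, as tau(2^((i+1)^2) x_n) is the i-th digit of n. *)

Require Import Defs.
From mathcomp Require Import all_boot all_order all_algebra.
From mathcomp Require Import all_classical all_reals all_analysis.
From mathcomp Require Import measurable_realfun ring lra zify.
Import Order.TTheory GRing.Theory Num.Theory numFieldTopology.Exports numFieldNormedType.Exports.
Local Open Scope classical_set_scope.
Local Open Scope ring_scope.

(** * Borel measurability in the plane *)

(** The rational boxes contained in [U] are countably many and exhaust it; each is a measurable
    rectangle. *)
Lemma open_bigcup_measurable2 {R : realType} (U : set (R * R)) : open U ->
  exists B : nat -> set (R * R),
    (forall n, measurable (B n)) /\ U = \bigcup_n B n.
Proof.
move=> oU.
pose box (q : rat * rat * rat) : set (R * R) :=
  [set x : R | `|ratr q.1.1 - x| < ratr q.2] `*`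
  [set x : R | `|ratr q.1.2 - x| < ratr q.2].
pose f (n : nat) : set (R * R) :=
  if unpickle n is Some q then
    if pselect (box q `<=` U) then box q else set0 else set0.
exists f; split.
  move=> n; rewrite /f; case: unpickle => // q; case: pselect => //= _.
  have mb (c r : R) : measurable [set x : R | `|c - x| < r].
    have -> : [set x : R | `|c - x| < r] = `]c - r, c + r[%classic.
      apply/seteqP; split => x /=; rewrite in_itv/= ltr_distlC.
        by move=> /andP[? ?]; apply/andP; split; lra.
      by move=> /andP[? ?]; apply/andP; split; lra.
    exact: measurable_itv.
  by apply: measurableX; exact: mb.
apply/seteqP; split => [[a b] Uab|x [n _]]; last first.
  rewrite /f; case: unpickle => // q; case: pselect => //= qU; exact: qU.
have [e /= e0 eU] : exists2 e : R, 0 < e & ball ((a, b) : R * R) e `<=` U.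
  by have /nbhs_ballP[e /= e0 eU] := open_nbhs_nbhs (conj oU Uab); exists e.
have h0 : 0 < e / 4 by rewrite divr_gt0.
(* With a radius in (e/4, e/2) and centres within e/4 of the coordinates, the box contains the point
   and stays within 3e/4 of it in each coordinate. *)
have /rat_in_itvoo[qr] : e / 4 < e / 2 by lra.
rewrite in_itv/= => /andP[r1 r2].
have near (c : R) : exists q : rat, `|ratr q - c| < e / 4.
  have /rat_in_itvoo[q] : c < c + e / 4 by lra.
  by rewrite in_itv/= => /andP[? ?]; exists q; rewrite ger0_norm; lra.
have [qa Ha] := near a; have [qb Hb] := near b.
exists (pickle (qa, qb, qr)); first exact: I.
rewrite /f pickleK.
case: pselect => /= [_|]; first by split => /=; apply: lt_trans r1.
move=> nU; exfalso; apply: nU; rewrite /box => -[x y] /= [xa yb]; apply: eU; split => /=.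
- rewrite -ball_normE/=.
  rewrite (_ : a - x = (ratr qa - x) - (ratr qa - a)); last by ring.
  by rewrite (le_lt_trans (ler_normB _ _))//; lra.
- rewrite -ball_normE/=.
  rewrite (_ : b - y = (ratr qb - y) - (ratr qb - b)); last by ring.
  by rewrite (le_lt_trans (ler_normB _ _))//; lra.
Qed.

Lemma open_measurable2 {R : realType} (U : set (R * R)) : open U -> measurable U.
Proof. by move=> /open_bigcup_measurable2[B [mB ->]]; exact: bigcup_measurable. Qed.

Lemma continuous_measurable2 {R : realType} (f : R * R -> R) :
  continuous f -> measurable_fun setT f.
Proof.
move=> cf; apply: (measurability _ (RGenOInfty.measurableE R)).
move=> _ [_ [a ->] <-]; rewrite setTI; apply: open_measurable2.
by move/continuousP: cf; apply; exact: interval_open.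
Qed.

(** * Integration against the weights [2 ^- n] on [nat] *)

Section nat_measure.
Context {R : realType}.

Lemma half_pow_ge0 (n : nat) : 0 <= (2^-1 : R) ^+ n.
Proof. by rewrite exprn_ge0. Qed.

(** Mass 2^-n at n. With the atoms indexed by [nat], sums over atoms become integrals, and the limit
    theorems for integrals apply to them. *)
Definition geom_measure : {measure set nat -> \bar R} :=
  mseries (fun n => mscale (NngNum (half_pow_ge0 n)) (dirac n)) 0.

Lemma geom_measureE (A : set nat) : geom_measure A =
  (\sum_(0 <= n <oo) (((2^-1) ^+ n)%:E * \d_n A))%E.
Proof. by []. Qed.

Lemma geom_measure1 (n : nat) : geom_measure [set n] = ((2^-1) ^+ n)%:E.
Proof.
rewrite geom_measureE (@nneseriesD1 R _ n)//; last first.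
  by move=> k _; apply: mule_ge0; [rewrite lee_fin half_pow_ge0|].
rewrite diracE mem_set// mule1 eseries0 ?adde0// => i _ /negP ni.
by rewrite diracE memNset ?mule0//= => ein; apply: ni; rewrite ein.
Qed.

Lemma geom_measureT : (geom_measure setT < +oo)%E.
Proof.
rewrite geom_measureE.
under eq_eseriesr do rewrite diracT mule1.
apply: (@le_lt_trans _ _ 2%:E); last by rewrite ltry.
apply: lime_le; first by apply: is_cvg_nneseries => n _ _; rewrite lee_fin half_pow_ge0.
apply: nearW => n; rewrite /= sumEFin lee_fin.
have -> : \sum_(0 <= i < n) (2^-1 : R) ^+ i = series (geometric 1 2^-1) n.
  by apply: eq_bigr => i _; rewrite /geometric/= mul1r.
apply: le_trans (geometric_le_lim _ _ _ _) _ => //.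
  by rewrite ger0_norm// invf_lt1// ltr1n.
rewrite mul1r (_ : (1 - 2^-1 : R)^-1 = 2)//.
by field.
Qed.

Lemma geom_measure_integrable (f : nat -> R) (M : R) :
  (forall n, `|f n| <= M) -> geom_measure.-integrable setT (EFin \o f).
Proof.
move=> fM; apply: measurable_bounded_integrable => //; first exact: geom_measureT.
exists M; split; first exact: num_real.
by move=> x Mx n _; apply: le_trans (fM n) (ltW Mx).
Qed.

(** Induction on [N]: the value at the last index is split off as a multiple of an indicator
    function. *)
Lemma Rintegral_geom_measure (f : nat -> R) (N : nat) :
  (forall n, (N <= n)%N -> f n = 0) ->
  Rintegral geom_measure setT f = \sum_(i < N) (2^-1) ^+ i * f i.
Proof.
elim: N f => [|N IH] f f0.
  rewrite big_ord0 (_ : f = fun=> 0); last by apply/funext => n; rewrite f0.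
  by rewrite /Rintegral integral0.
pose g n := if (n < N)%N then f n else 0.
have fE : f = (fun n => g n + f N * \1_[set N] n).
  apply/funext => n; rewrite /g indicE.
  have [nN|Nn|->] := ltngtP n N.
  - by rewrite memNset ?mulr0 ?addr0//= => nE; rewrite nE ltnn in nN.
  - by rewrite f0// memNset ?mulr0 ?addr0//= => nE; rewrite nE ltnn in Nn.
  - by rewrite mem_set// mulr1 add0r.
have ig : geom_measure.-integrable setT (EFin \o g).
  apply: (@geom_measure_integrable _ (\sum_(i < N) `|f i|)) => n.
  rewrite /g; case: ifPn => nN; last by rewrite normr0 sumr_ge0.
  by rewrite (bigD1 (Ordinal nN))//= lerDl sumr_ge0.
have ii : geom_measure.-integrable setT (EFin \o (\1_[set N] : nat -> R)).
  apply: (@geom_measure_integrable _ 1) => n.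
  by rewrite indicE; case: (_ \in _); rewrite ?normr1 ?normr0.
rewrite fE RintegralD//; last first.
  rewrite (_ : _ \o _ = (fun x => (f N)%:E * (EFin \o (\1_[set N] : nat -> R)) x)%E)//.
  exact: integrableZl.
rewrite RintegralZl// (IH g); last by move=> n Nn; rewrite /g ltnNge Nn.
rewrite big_ord_recr/=; congr (_ + _).
  apply: eq_bigr => i _; congr (_ * _).
  by rewrite /g ltn_ord indicE memNset ?mulr0 ?addr0//= => iE; have := ltn_ord i; rewrite iE ltnn.
rewrite /Rintegral integral_indic// setIT geom_measure1/= mulrC.
by rewrite /g ltnn indicE mem_set// mulr1 add0r.
Qed.

(** Dominated convergence: the constant bound is integrable because the total mass is finite. *)
Lemma continuous_Rintegral_geom (f : R -> nat -> R) (C : R) :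
  (forall x n, `|f x n| <= C) -> (forall n, continuous (f ^~ n)) ->
  continuous (fun x => Rintegral geom_measure setT (f x)).
Proof.
move=> fC cf a.
have aI : a \in (`]a - 1, a + 1[%classic : set R).
  by rewrite inE/= in_itv/=; lra.
apply: (@continuity_under_integral R _ _ geom_measure f setT _ (a - 1) (a + 1)
  _ _ (fun=> C)) => //.
- by move=> x _; exact: geom_measure_integrable (fC x).
- by apply: aeW => n _ x _; exact: cf.
- by apply: (@geom_measure_integrable _ `|C|) => n.
- by move=> x _; apply: aeW.
Qed.

Lemma is_derive_Rintegral_geom (f f' : R -> nat -> R) (C C' : R) :
  (forall x n, `|f x n| <= C) -> (forall x n, `|f' x n| <= C') ->
  (forall n (x : R), is_derive x 1 (f ^~ n) (f' x n)) ->
  forall x : R, is_derive x 1 (fun x => Rintegral geom_measure setT (f x))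
    (Rintegral geom_measure setT (f' x)).
Proof.
move=> fC f'C df a.
have E x n : partial1of2 f x n = f' x n.
  by rewrite /partial1of2 derive1E; apply: derive_val.
have aI : (`]a - 1, a + 1[%classic : set R) a by rewrite /= in_itv/=; lra.
have i1 x : `]a - 1, a + 1[%classic x -> geom_measure.-integrable setT (EFin \o f x).
  by move=> _; exact: geom_measure_integrable (fC x).
have d1 x n : `]a - 1, a + 1[%classic x -> [set: nat] n -> derivable (f ^~ n) x 1.
  by move=> _ _; have := df n x => ?; exact: ex_derive.
have ig : geom_measure.-integrable setT (EFin \o (fun=> `|C'|)).
  by apply: (@geom_measure_integrable _ `|C'|) => n; rewrite normr_id.
have gb x n : `]a - 1, a + 1[%classic x -> [set: nat] n -> `|partial1of2 f x n| <= `|C'|.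
  by move=> _ _; rewrite E (le_trans (f'C x n))// ler_norm.
have mT := @measurableT _ nat.
apply: DeriveDef.
  exact: (derivable_under_integral mT aI i1 d1 (fun=> normr_ge0 C') ig gb).
rewrite -derive1E (differentiation_under_integral mT aI i1 d1 (fun=> normr_ge0 C') ig gb).
by congr Rintegral; apply/funext => n; rewrite E.
Qed.

End nat_measure.

(** * Binary digits *)

Section digits.
Local Open Scope nat_scope.

Definition bit (i n : nat) : bool := odd (n %/ 2 ^ i).

Lemma bit_small i n : n < 2 ^ i -> bit i n = false.
Proof. by move=> ni; rewrite /bit divn_small. Qed.

Lemma bit_ge i n : n <= i -> bit i n = false.
Proof. by move=> ni; rewrite bit_small// (leq_ltn_trans ni)// ltn_expl. Qed.

Lemma bit_mod m i n : bit i (n %% 2 ^ m) = (i < m) && bit i n.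
Proof.
have [im|mi] /= := ltnP i m; last first.
  by rewrite bit_small// (leq_trans (ltn_pmod _ _)) ?expn_gt0// leq_exp2l.
(* For i < m the quotient by 2^m contributes a multiple of 2^(m-i) to n / 2^i. This is even, so the
   parity is that of the remainder. *)
rewrite /bit [in RHS](divn_eq n (2 ^ m)).
rewrite -[in RHS](subnK (ltnW im)) expnD mulnA addnC divnDMl ?expn_gt0//.
by rewrite oddD oddM oddX subn_eq0 leqNgt im andbF addbF -expnD subnK// ltnW.

Qed.

Lemma bit0 (b : bool) n : bit 0 (b + n.*2) = b.
Proof. by rewrite /bit expn0 divn1 oddD odd_double addbF oddb. Qed.

Lemma bitS i (b : bool) n : bit i.+1 (b + n.*2) = bit i n.
Proof. by rewrite /bit expnS divnMA divn2 half_bit_double. Qed.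

End digits.

Section digit_sums.
Context {R : realType}.
Implicit Types w : nat -> R.

(** The range [i < n] contains every nonzero digit because n < 2^n; by [digit_sumE] any longer range
    gives the same sum. *)
Definition digit_sum w n : R := \sum_(i < n) (bit i n)%:R * w i.

Lemma digit_sumE w n N : (n <= N)%N ->
  digit_sum w n = \sum_(0 <= i < N) (bit i n)%:R * w i.
Proof.
move=> nN; rewrite /digit_sum -(big_mkord xpredT (fun i => (bit i n)%:R * w i)).
rewrite [RHS](big_cat_nat _ nN)//=.
rewrite [X in _ = _ + X]big_nat_cond [X in _ = _ + X]big1 ?addr0// => i /andP[/andP[ni _] _].
by rewrite bit_ge// mul0r.
Qed.

(** Telescoping: the halving condition says that w_i <= 2 w_i - 2 w_(i+1). *)
Lemma sum_halving w : (forall i, 0 <= w i) -> (forall i, w i.+1 <= w i / 2) ->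
  forall m N, (m <= N)%N -> \sum_(m <= i < N) w i <= 2 * w m - 2 * w N.
Proof.
move=> w0 wh m N /subnKC <-; elim: (N - m)%N => [|k IH].
  by rewrite addn0 big_geq// subrr.
rewrite addnS big_nat_recr ?leq_addr//=.
by have := wh (m + k)%N; move: IH; lra.
Qed.

(** Reduction modulo 2^m keeps the m lowest digits, and the others add at most the tail 2 w_m. Hence
    all n in one residue class share an interval of length 2 w_m, which gives the covers by 2^m
    pieces. *)
Lemma digit_sum_mod w m n : (forall i, 0 <= w i) -> (forall i, w i.+1 <= w i / 2) ->
  digit_sum w (n %% 2 ^ m) <= digit_sum w n <= digit_sum w (n %% 2 ^ m) + 2 * w m.
Proof.
move=> w0 wh; pose N := maxn n m.
have mN : (m <= N)%N by rewrite leq_maxr.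
have nN : (n <= N)%N by rewrite leq_maxl.
have -> : digit_sum w (n %% 2 ^ m) = \sum_(0 <= i < m) (bit i n)%:R * w i.
  rewrite (digit_sumE w _ N); last by rewrite (leq_trans _ nN)// leq_mod.
  rewrite (big_cat_nat _ mN)//= [X in _ + X](_ : _ = 0) ?addr0.
    by apply: eq_big_nat => i /andP[_ im]; rewrite bit_mod im.
  rewrite big_nat_cond big1// => i /andP[/andP[mi _] _].
  by rewrite bit_mod ltnNge mi mul0r.
rewrite (digit_sumE w _ _ nN) (big_cat_nat _ mN)//=.
rewrite lerDl lerD2l sumr_ge0/=; last by move=> i _; rewrite mulr_ge0.
apply: (@le_trans _ _ (\sum_(m <= i < N) w i)).
  by apply: ler_sum => i _; rewrite ler_piMl// lern1 leq_b1.
apply: le_trans (sum_halving w w0 wh m N mN) _.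
by have := w0 N; lra.
Qed.

Lemma digit_sum_ge0 w n : (forall i, 0 <= w i) -> 0 <= digit_sum w n.
Proof. by move=> w0; apply: sumr_ge0 => i _; rewrite mulr_ge0. Qed.

Lemma digit_sum0 w : digit_sum w 0 = 0.
Proof. by rewrite /digit_sum big_ord0. Qed.

Lemma digit_sum_le w n : (forall i, 0 <= w i) -> (forall i, w i.+1 <= w i / 2) ->
  digit_sum w n <= 2 * w 0%N.
Proof.
move=> w0 wh; have := @digit_sum_mod w 0 n w0 wh.
by rewrite modn1 digit_sum0 add0r => /andP[].
Qed.

Definition xweight (i : nat) : R := (2 ^+ (i.+1 ^ 2))^-1.
Definition yweight (i : nat) : R := (2 ^+ i.+1)^-1.

Lemma xweight_ge0 i : 0 <= xweight i.
Proof. by rewrite invr_ge0 exprn_ge0. Qed.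

Lemma yweight_ge0 i : 0 <= yweight i.
Proof. by rewrite invr_ge0 exprn_ge0. Qed.

Lemma exp2_gt0 k : 0 < (2 : R) ^+ k. Proof. exact: exprn_gt0. Qed.

Lemma exp2_div a b : (b <= a)%N -> (2 : R) ^+ a / 2 ^+ b = 2 ^+ (a - b).
Proof.
move=> ba; rewrite -{1}(subnK ba) exprD -mulrA divff ?mulr1//.
Qed.

Lemma exp2_divV a b : (a <= b)%N -> (2 : R) ^+ a / 2 ^+ b = (2 ^+ (b - a))^-1.
Proof. by move=> ab; rewrite -exp2_div// invfM invrK mulrC. Qed.

Lemma xweightM i j : (i <= j)%N ->
  2 ^+ (i.+1 ^ 2) * xweight j = (2 ^+ (j.+1 ^ 2 - i.+1 ^ 2))^-1.
Proof. by move=> ij; rewrite /xweight exp2_divV// leq_exp2r. Qed.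

Lemma xweight_half i : xweight i.+1 <= xweight i / 2.
Proof.
rewrite /xweight -invfM.
have -> : (2 : R) ^+ (i.+1 ^ 2) * 2 = 2 ^+ (i.+1 ^ 2).+1 by rewrite exprS mulrC.
rewrite lef_pV2 ?posrE ?exp2_gt0//.
by rewrite ler_eXn2l ?ltr1n//; nia.
Qed.

Lemma yweight_half i : yweight i.+1 <= yweight i / 2.
Proof. by rewrite /yweight -invfM exprS mulrC. Qed.

Definition xdig n := digit_sum xweight n.
Definition ydig n := digit_sum yweight n.

Lemma ydig_cons (b : bool) n : ydig (b + n.*2) = b%:R / 2 + ydig n / 2.
Proof.
have h : (b + n.*2 <= (n.*2).+1)%N by case: b.
rewrite /ydig (digit_sumE _ _ _ h) (@digit_sumE _ n n.*2); last by rewrite -addnn leq_addr.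
rewrite big_nat_recl//= bit0 /yweight expr1; congr (_ + _).
rewrite mulr_suml; apply: eq_bigr => i _.
by rewrite bitS -mulrA; congr (_ * _); rewrite [in RHS]mulrC -invfM -exprS.
Qed.

(** Bit reversal: the leading binary digit of j, found by comparing j with half of the power of two,
    becomes the lowest digit of n. *)
Lemma ydig_dyadic m j : (j < 2 ^ m)%N -> exists n, ydig n = j%:R / 2 ^+ m.
Proof.
elim: m j => [|m IH] j.
  rewrite expn0 ltnS leqn0 => /eqP ->; exists 0%N.
  by rewrite /ydig digit_sum0 mul0r.
rewrite expnS mul2n => jm.
have [jm'|mj] := ltnP j (2 ^ m).
  have [n yn] := IH j jm'; exists (false + n.*2)%N.
  by rewrite ydig_cons mul0r add0r yn exprS invfM; ring.
have [|n yn] := IH (j - 2 ^ m)%N; first by lia.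
exists (true + n.*2)%N; rewrite ydig_cons yn natrB// natrX exprS invfM.
rewrite (_ : true%:R = 1 :> R)//; field.
by rewrite expf_neq0.
Qed.

(** * Reading digits with a continuous periodic function *)

(** Truncation to [0, 1], written with absolute values so that continuity is immediate. *)
Definition clamp01 (t : R) : R := (`|t| - `|t - 1| + 1) / 2.

Lemma clamp01_le0 t : t <= 0 -> clamp01 t = 0.
Proof. by move=> t0; rewrite /clamp01 !ler0_norm; lra. Qed.

Lemma clamp01_ge1 t : 1 <= t -> clamp01 t = 1.
Proof. by move=> t1; rewrite /clamp01 !ger0_norm; lra. Qed.

Lemma clamp01_itv t : 0 <= clamp01 t <= 1.
Proof.
have [t0|t0] := leP t 0; first by rewrite clamp01_le0// lexx ler01.
have [t1|t1] := leP 1 t; first by rewrite clamp01_ge1// lexx ler01.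
by rewrite /clamp01 ger0_norm 1?ler0_norm; lra.
Qed.

Lemma clamp01_id t : 0 <= t <= 1 -> clamp01 t = t.
Proof. by move=> /andP[t0 t1]; rewrite /clamp01 ger0_norm 1?ler0_norm; lra. Qed.

Lemma norm_clamp01 t : `|clamp01 t| <= 1.
Proof. by have /andP[t0 t1] := clamp01_itv t; rewrite ger0_norm. Qed.

Lemma continuous_clamp01 : continuous clamp01.
Proof.
move=> t; apply: cvgMr_tmp; apply: cvgD; last exact: cvg_cst.
apply: cvgB; first exact: norm_continuous.
by apply: cvg_norm; apply: cvgB; [exact: cvg_id|exact: cvg_cst].
Qed.

(** The function tau of the overview. On [0, 1/4] the cosine is at least 1/2, so the clamped
    argument is at most 0; a shift of z by 1 changes the sign of the cosine, and the argument is at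
    least 1. *)
Definition digit_wave (z : R) : R := clamp01 (2^-1 - cos (pi * z)).

Lemma continuous_digit_wave : continuous digit_wave.
Proof.
move=> z; apply: (cvg_comp (fun z => 2^-1 - cos (pi * z)) clamp01); last exact: continuous_clamp01.
apply: cvgB; first exact: cvg_cst.
apply: (cvg_comp (fun z => pi * z) cos); last exact: continuous_cos.
by apply: cvgMl_tmp; exact: cvg_id.
Qed.

Lemma cos_quarter (t : R) : 0 <= t <= 4^-1 -> 2^-1 <= cos (pi * t).
Proof.
move=> /andP[t0 t1]; have pi0 := pi_gt0 R.
have pt0 : 0 <= pi * t by rewrite mulr_ge0// ltW.
have pt1 : pi * t <= pi / 4 by rewrite ler_pM2l.
have c0 : 0 <= cos (pi * t).
  by apply: cos_ge0_pihalf; apply/andP; split; lra.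
(* The doubled angle is at most pi/2, so 2 cos^2 - 1 >= 0, which with a nonnegative cosine gives
   more than 1/2. *)
have : 0 <= cos ((pi * t) *+ 2).
  by apply: cos_ge0_pihalf; rewrite (mulr2n (pi * t)); apply/andP; split; lra.
by rewrite cos_mulr2n (mulr2n (cos _ ^+ 2)); nra.
Qed.

Lemma digit_waveE (k : nat) (b : bool) (t : R) : 0 <= t <= 4^-1 ->
  digit_wave (k.*2%:R + b%:R + t) = b%:R.
Proof.
move=> /cos_quarter ct; rewrite /digit_wave.
have -> : pi * (k.*2%:R + b%:R + t) = pi * (b%:R + t) + pi *+ 2 *+ k.
  by rewrite -mulrnA mul2n -[in RHS]mulr_natr; ring.
rewrite (periodicn (@cosD2pi R)); case: b.
  rewrite [1 + t]addrC mulrDr mulr1 cosDpi/=.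
  by rewrite clamp01_ge1//; lra.
by rewrite add0r/= clamp01_le0//; lra.
Qed.

(** Scaling by 2^((i+1)^2) turns the digits below i into an even integer, digit i into itself and
    the digits above i into a remainder in [0, 1/4], which is the form that [digit_waveE] treats. *)
Lemma digit_wave_xdig i n : digit_wave (2 ^+ (i.+1 ^ 2) * xdig n) = (bit i n)%:R.
Proof.
pose N := maxn n i.+1.
have iN : (i.+1 <= N)%N by rewrite leq_maxr.
have nN : (n <= N)%N by rewrite leq_maxl.
rewrite /xdig (digit_sumE _ _ _ nN) (big_cat_nat _ iN)//=.
rewrite big_nat_recr//= !mulrDr.
have -> : 2 ^+ (i.+1 ^ 2) * ((bit i n)%:R * xweight i) = (bit i n)%:R.
  by rewrite mulrCA xweightM// subnn expr0 invr1 mulr1.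
(* Half of the even integer made by the lower digits; the exponents are positive since j < i, so a
   factor 2 can be taken out. *)
pose k := (\sum_(0 <= j < i) bit j n * 2 ^ (i.+1 ^ 2 - j.+1 ^ 2).-1)%N.
have -> : 2 ^+ (i.+1 ^ 2) * (\sum_(0 <= j < i) (bit j n)%:R * xweight j) = k.*2%:R.
  rewrite /k -muln2 big_distrl/= natr_sum mulr_sumr.
  apply: eq_big_nat => j /andP[_ ji].
  rewrite -mulnA -expnSr prednK ?subn_gt0 ?ltn_exp2r// natrM natrX mulrCA; congr (_ * _).
  by rewrite /xweight exp2_div// leq_exp2r// ltnW.
apply: digit_waveE; apply/andP; split.
  rewrite mulr_ge0 ?exprn_ge0// sumr_ge0// => j _.
  by rewrite mulr_ge0 ?xweight_ge0.
apply: (@le_trans _ _ (2 ^+ (i.+1 ^ 2) * (2 * xweight i.+1))).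
  rewrite ler_pM2l ?exprn_gt0//.
  apply: (@le_trans _ _ (\sum_(i.+1 <= j < N) xweight j)).
    by apply: ler_sum => j _; rewrite ler_piMl ?xweight_ge0// lern1 leq_b1.
  apply: le_trans (sum_halving _ xweight_ge0 xweight_half _ _ iN) _.
  by have := xweight_ge0 N; lra.
rewrite mulrCA xweightM//.
(* The gap 2i + 3 between consecutive exponents bounds the scaled tail by 2 / 2^(2i+3) <= 1/4. *)
have -> : (i.+2 ^ 2 - i.+1 ^ 2 = 3 + i.*2)%N by lia.
rewrite exprD invfM mulrA (_ : 2 / 2 ^+ 3 = 4^-1); last by field.
by rewrite ler_piMr// invf_le1 ?exprn_gt0// exprn_ege1// ler1n.
Qed.

End digit_sums.

(** * Hausdorff dimension *)

Section hausdorff.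
Context {R : realType}.
Implicit Types (A U : set (R * R)) (p q : R * R).

Lemma dist2xx p : dist2 p p = 0.
Proof. by rewrite /dist2 !subrr !expr0n/= addr0 sqrtr0. Qed.

Lemma dist2_le p q (a b : R) : `|p.1 - q.1| <= a -> `|p.2 - q.2| <= b ->
  dist2 p q <= a + b.
Proof.
move=> pa pb; have a0 := le_trans (normr_ge0 _) pa; have b0 := le_trans (normr_ge0 _) pb.
rewrite /dist2 -[leRHS]ger0_norm ?addr_ge0// -sqrtr_sqr ler_wsqrtr//.
rewrite -[leLHS](_ : `|p.1 - q.1| ^+ 2 + `|p.2 - q.2| ^+ 2 = _); last by rewrite !real_normK ?num_real.
have := normr_ge0 (p.1 - q.1); have := normr_ge0 (p.2 - q.2).
by move: `|_| `|_| pa pb => u v; nra.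
Qed.

Lemma snd_dist2 p q : `|p.2 - q.2| <= dist2 p q.
Proof. by rewrite /dist2 -sqrtr_sqr ler_wsqrtr// lerDr sqr_ge0. Qed.

Lemma diam2_le U (d : R) : 0 <= d -> (forall p q, U p -> U q -> dist2 p q <= d) ->
  diam2 U <= d.
Proof.
move=> d0 Ud; rewrite /diam2.
have [->|/set0P[p Up]] := eqVneq U set0.
  by rewrite setX0 image_set0 sup0.
apply: ge_sup; first by exists (dist2 p p), (p, p).
by move=> _ [[x y] [Ux Uy]] <-; exact: Ud.
Qed.

Lemma dist2_le_diam2 U (d : R) p q : (forall p q, U p -> U q -> dist2 p q <= d) ->
  U p -> U q -> dist2 p q <= diam2 U.
Proof.
move=> Ud Up Uq; apply: ub_le_sup; last by exists (p, q).
by exists d => _ [[x y] [Ux Uy]] <-; exact: Ud.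
Qed.

Lemma diam2_ge0 U (d : R) : (forall p q, U p -> U q -> dist2 p q <= d) -> 0 <= diam2 U.
Proof.
move=> Ud; have [->|/set0P[p Up]] := eqVneq U set0.
  by rewrite /diam2 setX0 image_set0 sup0.
by rewrite -(dist2xx p); exact: (dist2_le_diam2 _ _ _ _ Ud Up Up).
Qed.

Lemma diam2_set0 : diam2 (set0 : set (R * R)) = 0.
Proof. by rewrite /diam2 setX0 image_set0 sup0. Qed.

Lemma hausdorff_content_ge0 (s delta : R) A : (0 <= hausdorff_content s delta A)%E.
Proof.
apply: le_ereal_inf_tmp => _ [U _ <-].
by apply: nneseries_ge0 => i _ _; rewrite lee_fin powR_ge0.
Qed.

(** A finite cover by N sets with common diameter bound d costs at most N d^s, so every content is
    below each [eps]. *)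
Lemma hausdorff_measure_eq0 (s : R) A : 0 < s ->
  (forall delta eps : R, 0 < delta -> 0 < eps ->
    exists (N : nat) (d : R) (U : nat -> set (R * R)),
    [/\ A `<=` \bigcup_(i < N) U i, forall i p q, U i p -> U i q -> dist2 p q <= d,
        0 <= d <= delta & N%:R * d `^ s <= eps]) ->
  hausdorff_measure s A = 0%E.
Proof.
move=> s0 H; suff E (delta : R) : 0 < delta -> hausdorff_content s delta A = 0%E.
  rewrite /hausdorff_measure -[RHS]ereal_sup1; congr ereal_sup.
  apply/seteqP; split => [_ [d d0 <-]/=|_ ->]; first exact: E.
  by exists 1; [exact: ltr01|exact/E/ltr01].
move=> delta0; apply/eqP; rewrite eq_le hausdorff_content_ge0 andbT.
apply/lee_addgt0Pr => eps eps0; rewrite add0e.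
have [N [d [U [AU Ud /andP[d0 dd] Nd]]]] := H delta eps delta0 eps0.
(* The finite cover is padded with empty sets. They cost nothing: the supremum over the empty set is
   0 by default, and 0^s = 0 for s > 0. *)
pose V i := if (i < N)%N then U i else set0.
have Vd i p q : V i p -> V i q -> dist2 p q <= d.
  by rewrite /V; case: ifPn => // _; exact: Ud.
apply: (@le_trans _ _ (\sum_(i <oo) ((diam2 (V i)) `^ s)%:E)%E).
  apply: ereal_inf_lbound; exists V => //; split.
    move=> x /AU[i /= iN Uix]; exists i => //; by rewrite /V iN.
  by move=> i p q Vp Vq; apply: le_trans dd; exact: Vd Vp Vq.
rewrite (nneseries_split 0 N); last by move=> k _; rewrite lee_fin powR_ge0.
rewrite [X in (_ + X)%E]eseries0 ?adde0; last first.
  move=> i Ni _; rewrite /V ltnNge add0n in Ni *; rewrite Ni/= diam2_set0 powR0//.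
  by rewrite gt_eqF.
rewrite sumEFin lee_fin (le_trans _ Nd)//.
apply: (@le_trans _ _ (\sum_(0 <= i < 0 + N) d `^ s)).
  apply: ler_sum => i _; apply: ge0_ler_powR; rewrite ?nnegrE//; first exact: ltW.
    by apply: diam2_ge0 => p q; exact: Vd.
  by apply: diam2_le => // p q; exact: Vd.
by rewrite sumr_const_nat add0n subn0 mulr_natl.
Qed.

(** Projection to the second axis: pieces of diameter d_i <= 1 yield intervals of length 2 d_i
    covering [0, 1], and d_i <= d_i^s because s < 1. Hence every cover costs at least 1/2. *)
Lemma hausdorff_measure_neq0 (s : R) A : 0 < s < 1 ->
  (forall y, 0 <= y <= 1 -> exists x, A (x, y)) -> hausdorff_measure s A != 0%E.
Proof.
move=> /andP[s0 s1] Ay; rewrite gt_eqF//.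
apply: (@lt_le_trans _ _ (2^-1)%:E); first by rewrite lte_fin invr_gt0.
apply: (@le_trans _ _ (hausdorff_content s 1 A)); last first.
  by apply: ereal_sup_ubound; exists 1 => //=.
apply: le_ereal_inf_tmp => _ [U [AU Ud] <-].
pose d i := diam2 (U i).
have d0 i : 0 <= d i by apply: diam2_ge0; exact: Ud.
have d1 i : d i <= 1 by apply: diam2_le => //; exact: Ud.
(* The height of some point of the piece, or 0 for an empty piece; the interval of radius [d i]
   about it contains the projection of the piece. *)
pose y i := (xget (0, 0) (U i)).2.
pose I i : set R := `[y i - d i, y i + d i]%classic.
have mI i : measurable (I i) by exact: measurable_itv.
have leI i : (lebesgue_measure (I i) <= 2%:E * (d i `^ s)%:E)%E.
  rewrite lebesgue_measure_itv/= lte_fin; case: ifPn => _; last first.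
    by rewrite mule_ge0// lee_fin ?powR_ge0.
  rewrite -EFinB -EFinM lee_fin.
  rewrite (_ : _ - _ = 2 * d i); last by ring.
  rewrite ler_pM2l//; have [->|dn0] := eqVneq (d i) 0; first by rewrite powR_ge0.
  rewrite -[leLHS]powRr1//; apply: ger_powR; last exact: ltW.
  by rewrite lt_neqAle eq_sym dn0 d0 d1.
have : (lebesgue_measure (`[0%R, 1%R]%classic : set R) <= \sum_(i <oo) lebesgue_measure (I i))%E.
  apply: measure_sigma_subadditive => // t; rewrite /= in_itv/= => t01.
  have [x Axt] := Ay t t01.
  have [i _ Uit] := AU _ Axt.
  exists i => //; rewrite /I/= in_itv/=.
  have : `|t - y i| <= d i.
    have Ug : U i (xget (0, 0) (U i)) by apply: xgetPex; exists (x, t).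
    exact: le_trans (snd_dist2 (x, t) _) (dist2_le_diam2 _ _ _ _ (Ud i) Uit Ug).
  by rewrite ler_norml => /andP[? ?]; apply/andP; split; lra.
rewrite lebesgue_measure_itv/= lte_fin ltr01 oppr0 adde0 => le1.
have : (1 <= 2%:E * \sum_(i <oo) ((d i `^ s)%:E))%E.
  apply: le_trans le1 _; rewrite -nneseriesZl//; last first.
    by move=> i _; rewrite lee_fin powR_ge0.
  by apply: lee_nneseries => // i _.
by rewrite muleC -lee_pdivrMr// mul1e.
Qed.

Lemma hausdorff_dim0 A : (forall s : R, 0 < s -> hausdorff_measure s A = 0%E) ->
  hausdorff_dim A = 0%E.
Proof.
move=> H; apply/eqP; rewrite eq_le; apply/andP; split.
  apply/lee_addgt0Pr => eps eps0; rewrite add0e.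
  by apply: ereal_inf_lbound; exists eps => //; split => //; exact: H.
by apply: le_ereal_inf_tmp => _ [s [s0 _] <-]; rewrite lee_fin ltW.
Qed.

Lemma hausdorff_dim1 A : (forall s : R, 1 < s -> hausdorff_measure s A = 0%E) ->
  (forall s : R, 0 < s < 1 -> hausdorff_measure s A != 0%E) ->
  hausdorff_dim A = 1%E.
Proof.
move=> H H1; apply/eqP; rewrite eq_le; apply/andP; split.
  apply/lee_addgt0Pr => eps eps0; rewrite -EFinD.
  apply: ereal_inf_lbound; exists (1 + eps) => //.
  by split; [rewrite addr_gt0|apply: H; rewrite ltrDl].
apply: le_ereal_inf_tmp => _ [s [s0 Hs] <-]; rewrite lee_fin leNgt; apply/negP => s1.
by have := H1 s; rewrite s0 s1 Hs eqxx => /(_ isT).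
Qed.

(** * Cost of covers by dyadically many pieces *)

Lemma exp_half_small (eps : R) : 0 < eps -> exists L : nat, (2 ^+ L)^-1 <= eps.
Proof.
move=> eps0; exists (Num.truncn eps^-1).+1.
rewrite -[leRHS]invrK lef_pV2 ?posrE ?invr_gt0 ?exprn_gt0//.
apply: le_trans (ltW (truncnS_gt _)) _.
by rewrite -natrX ler_nat ltnW// ltn_expl.
Qed.

Lemma powR2N (L : nat) : (2 : R) `^ (- L%:R) = (2 ^+ L)^-1.
Proof. by rewrite powRN powR_mulrn. Qed.

(** The 2^m + 1 pieces are at most 2^(m+1), and each has diameter at most 2^(1 - k m). The
    hypothesis makes the base 2 logarithm of the resulting cost arbitrarily negative. *)
Lemma cover_decay (k : nat -> nat) (s : R) :
  (forall L : nat, exists m, m.+1%:R + (1 - (k m)%:R) * s <= - L%:R /\ (L < k m)%N) ->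
  forall delta eps : R, 0 < delta -> 0 < eps -> exists m,
    2 / 2 ^+ k m <= delta /\ (2 ^ m).+1%:R * (2 / 2 ^+ k m) `^ s <= eps.
Proof.
move=> H delta eps delta0 eps0.
have [L HL] : exists L : nat, (2 ^+ L)^-1 <= Num.min delta eps.
  by apply: exp_half_small; rewrite lt_min delta0.
move: HL; rewrite le_min => /andP[Ld Le].
have [m [Hm Lk]] := H L.
have E : 2 / 2 ^+ k m = (2 : R) `^ (1 - (k m)%:R).
  by rewrite powRD ?pnatr_eq0 ?implybT// powRr1// powR2N.
have le2 (x y : R) : x <= y -> (2 : R) `^ x <= 2 `^ y.
  by move=> xy; rewrite ler_powR// ler1n.
exists m; rewrite E; split.
  apply: le_trans Ld; rewrite -powR2N; apply: le2.
  by move: Lk; rewrite -(ler_nat R) -(@natr1 R L); lra.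
apply: (@le_trans _ _ ((2 : R) `^ (m.+1%:R + (1 - (k m)%:R) * s))); last first.
  by apply: le_trans Le; rewrite -powR2N; exact: le2.
rewrite [leRHS]powRD ?pnatr_eq0 ?implybT// -powRrM ler_wpM2r ?powR_ge0//.
rewrite powR_mulrn// -natrX ler_nat expnS mul2n -addnn -addn1 leq_add2l.
by rewrite expn_gt0.
Qed.

Lemma fast_decay (s : R) : 0 < s -> forall L : nat, exists m,
  m.+1%:R + (1 - (m.+1 ^ 2)%:R) * s <= - L%:R /\ (L < m.+1 ^ 2)%N.
Proof.
move=> s0 L; pose m := maxn L (Num.truncn (3 / s)).+1.
have Lm : (L <= m)%N by rewrite leq_maxl.
have m1 : (1 <= m)%N by rewrite leq_max orbT.
(* Then (1 - (m+1)^2) s = -(m+2) m s <= -3 (m+2), so the exponent is at most -2m - 5 <= -L. *)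
have sm : 3 <= m%:R * s.
  rewrite -ler_pdivrMr//; apply: le_trans (ltW (truncnS_gt _)) _.
  by rewrite ler_nat leq_maxr.
exists m; split; last by nia.
have : L%:R <= m%:R :> R by rewrite ler_nat.
have : 1 <= m%:R :> R by rewrite ler1n.
rewrite natrX -natr1; move: sm; move: (m%:R : R) => x; nra.
Qed.

Lemma slow_decay (s : R) : 1 < s -> forall L : nat, exists m,
  m.+1%:R + (1 - m%:R) * s <= - L%:R /\ (L < m)%N.
Proof.
move=> s1 L; have s10 : 0 < s - 1 by rewrite subr_gt0.
(* The exponent equals 1 + s - m (s - 1), so the bound asks for m (s - 1) >= 1 + s + L. *)
pose m := maxn L.+1 (Num.truncn ((1 + s + L%:R) / (s - 1))).+1.
exists m; split; last by rewrite leq_maxl.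
have : 1 + s + L%:R <= m%:R * (s - 1).
  rewrite -ler_pdivrMr//; apply: le_trans (ltW (truncnS_gt _)) _.
  by rewrite ler_nat leq_maxr.
by rewrite -natr1; move: (m%:R : R) => x; nra.
Qed.

End hausdorff.

(** * The moving atoms *)

Section atoms.
Context {R : realType}.

(** Index 0 is the resting atom of mass 1; index k + 1 is the moving atom at x_k, whose mass is
    2^-(k+1). *)
Definition atomX (n : nat) : R := if n is k.+1 then xdig k else -2.
Definition atomY (n : nat) : R := if n is k.+1 then ydig k else 0.
Definition atom (t : R) (n : nat) : R * R := (atomX n, t * atomY n).

Lemma xdig_itv n : 0 <= (xdig n : R) <= 1.
Proof.
rewrite digit_sum_ge0 ?(le_trans (digit_sum_le _ _ xweight_ge0 xweight_half))//=.
  by rewrite /xweight exp1n expr1; lra.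
exact: xweight_ge0.
Qed.

Lemma ydig_itv n : 0 <= (ydig n : R) <= 1.
Proof.
rewrite digit_sum_ge0 ?(le_trans (digit_sum_le _ _ yweight_ge0 yweight_half))//=.
  by rewrite /yweight expr1; lra.
exact: yweight_ge0.
Qed.

Lemma atomY_itv n : 0 <= (atomY n : R) <= 1.
Proof. by case: n => [|n]; [rewrite lexx ler01|exact: ydig_itv]. Qed.

Lemma measurable_atom t : measurable_fun setT (atom t).
Proof. by []. Qed.

Definition omega (t : R) : {measure set (R * R) -> \bar R}.
Proof.
refine (pushforward geom_measure (atom t) : {measure set (R * R) -> \bar R}).
exact: measurable_atom.
Defined.

Lemma omegaE t A : omega t A = geom_measure (atom t @^-1` A).
Proof. by []. Qed.

Lemma omegaT t : (omega t setT < +oo)%E.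
Proof. by rewrite omegaE preimage_setT; exact: geom_measureT. Qed.

Lemma omega_integrable t (f : R * R -> R) (M : R) : measurable_fun setT f ->
  (forall n, `|f (atom t n)| <= M) -> (omega t).-integrable setT (EFin \o f).
Proof.
move=> mf fM; apply: integrable_pushforward => //.
  exact/measurable_EFinP.
exact: (@geom_measure_integrable _ (f \o atom t)) fM.
Qed.

Lemma Rintegral_omega t (f : R * R -> R) (M : R) : measurable_fun setT f ->
  (forall n, `|f (atom t n)| <= M) ->
  Rintegral (omega t) setT f = Rintegral geom_measure setT (f \o atom t).
Proof.
move=> mf fM; rewrite /Rintegral integral_pushforward//.
  exact/measurable_EFinP.
by rewrite preimage_setT; exact: (@geom_measure_integrable _ (f \o atom t)) fM.
Qed.

Lemma atom_msupport t n : msupport (omega t) (atom t n).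
Proof.
move=> U oU Un; rewrite omegaE.
apply: (@lt_le_trans _ _ (geom_measure [set n])).
  by rewrite geom_measure1 lte_fin exprn_gt0.
by apply: le_measure; rewrite ?inE// => _ ->.
Qed.

Lemma msupport_sub t (F : set (R * R)) : closed F -> (forall n, F (atom t n)) ->
  msupport (omega t) `<=` F.
Proof.
move=> cF Fn x sx; apply: contrapT => nFx.
have := sx (~` F) (closed_openC cF) nFx.
rewrite omegaE (_ : _ @^-1` _ = set0) ?measure0 ?ltxx//.
by apply/seteqP; split => n //= nFn; exact: (nFn (Fn n)).
Qed.

Lemma closed_msupport t : closed (msupport (omega t)).
Proof.
move=> x cx U oU Ux.
have [y [sy Uy]] := cx U (open_nbhs_nbhs (conj oU Ux)).
exact: sy Uy.
Qed.

Lemma closed_box (a b c d : R) : closed (`[a, b] `*` `[c, d] : set (R * R)).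
Proof.
rewrite (_ : _ `*` _ = fst @^-1` `[a, b] `&` snd @^-1` `[c, d])//.
by apply: closedI; apply: preimage_closed;
  [move=> x _; exact: cvg_fst|exact: interval_closed|move=> x _; exact: cvg_snd|
  exact: interval_closed].
Qed.

(** Piece 0 is the point of the resting atom. For j < 2^m, piece j + 1 is a box holding the moving
    atoms whose number is congruent to j modulo 2^m. All pieces are closed, so a finite union that
    contains the atoms contains the support. *)
Definition cover_piece (t : R) (m i : nat) : set (R * R) :=
  if i is j.+1 then
    `[xdig j, xdig j + 2 * xweight m] `*` `[t * ydig j, t * (ydig j + 2 * yweight m)]
  else `[-2, -2] `*` `[0, 0].

Lemma msupport_cover t m : 0 <= t ->
  msupport (omega t) `<=` \bigcup_(i < (2 ^ m).+1) cover_piece t m i.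
Proof.
move=> t0; apply: msupport_sub.
  apply: closed_bigcup => // -[|j] _; exact: closed_box.
case=> [|n].
  by exists 0%N => //; split => /=; rewrite in_itv/= ?mulr0 ?lexx.
exists (n %% 2 ^ m).+1; first by rewrite /= ltnS ltn_pmod// expn_gt0.
have /andP[x1 x2] := digit_sum_mod _ m n (@xweight_ge0 R) xweight_half.
have /andP[y1 y2] := digit_sum_mod _ m n (@yweight_ge0 R) yweight_half.
by split => /=; rewrite in_itv/=; apply/andP; split => //; rewrite ler_wpM2l.
Qed.

Lemma cover_piece_diam t m i p q : 0 <= t -> cover_piece t m i p -> cover_piece t m i q ->
  dist2 p q <= 2 * xweight m + t * (2 * yweight m).
Proof.
move=> t0.
have H (a b u v : R) : a <= u <= b -> a <= v <= b -> `|u - v| <= b - a.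
  by move=> /andP[? ?] /andP[? ?]; rewrite ler_norml; apply/andP; split; lra.
have X0 := @xweight_ge0 R m.
have Y0 : 0 <= t * (2 * yweight m) by rewrite !mulr_ge0// yweight_ge0.
case: i => [|j] [/= p1 p2] [/= q1 q2]; rewrite !in_itv/= in p1 p2 q1 q2.
  by apply: dist2_le; apply: le_trans (H _ _ _ _ _ _) _; [exact: p1|exact: q1|lra|exact: p2|exact: q2|lra].
apply: dist2_le; apply: le_trans (H _ _ _ _ _ _) _; [exact: p1|exact: q1|lra|exact: p2|exact: q2|].
by rewrite mulrDr; lra.
Qed.

Lemma hausdorff_msupport_eq0 t s (k : nat -> nat) : 0 <= t -> 0 < s ->
  (forall m, 2 * xweight m + t * (2 * yweight m) <= 2 / 2 ^+ k m) ->
  (forall L : nat, exists m, m.+1%:R + (1 - (k m)%:R) * s <= - L%:R /\ (L < k m)%N) ->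
  hausdorff_measure s (msupport (omega t)) = 0%E.
Proof.
move=> t0 s0 km /cover_decay H; apply: hausdorff_measure_eq0 => // delta eps delta0 eps0.
have [m [md me]] := H _ _ delta0 eps0.
exists (2 ^ m).+1, (2 / 2 ^+ k m), (cover_piece t m); split => //.
- exact: msupport_cover.
- by move=> i p q ip iq; apply: le_trans (km m); exact: cover_piece_diam ip iq.
- by rewrite md divr_ge0 ?exprn_ge0.
Qed.

(** At time 0 all heights vanish, so only the horizontal size 2 / 2^((m+1)^2) of the pieces
    counts. *)
Lemma hausdorff_dim_omega0 : hausdorff_dim (msupport (omega 0)) = 0%E.
Proof.
apply: hausdorff_dim0 => s s0.
apply: (hausdorff_msupport_eq0 _ _ (fun m => m.+1 ^ 2)%N) => //.
  by move=> m; rewrite mul0r addr0.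
exact: fast_decay.
Qed.

(** The support is compact, so its projection is closed; the projection contains the heights y_n,
    which include all dyadic numbers of [0, 1[. *)
Lemma msupport_omega1_snd y : 0 <= y <= 1 -> exists x, msupport (omega 1) (x, y).
Proof.
move=> /andP[y0 y1].
have cS : compact (msupport (omega 1)).
  have cB : compact (`[-2, 1]%classic `*` `[0, 1]%classic : set (R * R)).
    by apply: compact_setX; exact: segment_compact.
  apply: (subclosed_compact (closed_msupport 1) cB).
  apply: msupport_sub; first exact: closed_box.
  case=> [|n]; split => /=; rewrite in_itv/= ?mul1r.
  - by rewrite lexx; lra.
  - by rewrite lexx ler01.
  - by have /andP[x0 x1] := xdig_itv n; rewrite x1 andbT; lra.
  - exact: ydig_itv.
have : (snd @` msupport (omega 1)) y.
  have : closed (snd @` msupport (omega 1)).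
    apply: compact_closed => //; apply: continuous_compact => //.
    by apply: continuous_subspaceT => x; exact: cvg_snd.
  apply => B /nbhs_ballP[e /= e0 eB].
  have [m me] := exp_half_small (e / 2) (divr_gt0 e0 (ltr0Sn R 1)).
  have e2 : 0 < (2 : R) ^+ m by rewrite exprn_gt0.
  have [j jm jy] : exists2 j, (j < 2 ^ m)%N & `|y - j%:R / 2 ^+ m| <= (2 ^+ m)^-1.
    have H j : `|y * 2 ^+ m - j%:R| <= 1 -> `|y - j%:R / 2 ^+ m| <= (2 ^+ m)^-1.
      move=> h; rewrite -[leRHS]mul1r -[X in `|X - _|](mulfK (lt0r_neq0 e2)) -mulrBl.
      by rewrite normrM ler_pM ?normr_ge0// ger0_norm// invr_ge0 ltW.
    pose j := Num.truncn (y * 2 ^+ m).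
    have /truncn_itv/andP[j1 j2] : 0 <= y * 2 ^+ m by rewrite mulr_ge0// ltW.
    have [jm|mj] := ltnP j (2 ^ m).
      exists j => //; apply: H; rewrite ger0_norm; first by rewrite -natr1 in j2; lra.
      by rewrite subr_ge0.
    (* Only y = 1 leads here: the integer part is then 2^m, out of range, and the last dyadic point
       1 - 2^-m is near enough. *)
    exists (2 ^ m).-1; first by rewrite prednK ?expn_gt0.
    apply: H; rewrite -subn1 natrB ?expn_gt0// natrX ler_norml.
    have : 2 ^+ m <= y * 2 ^+ m.
      by apply: (le_trans _ j1); have := mj; rewrite -(ler_nat R) natrX.
    have : y * 2 ^+ m <= 2 ^+ m by rewrite ler_piMl// ltW.
    by move=> ? ?; apply/andP; split; lra.
  have [n yn] := @ydig_dyadic R m j jm.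
  exists (ydig n); split.
    exists (atom 1 n.+1); first exact: atom_msupport.
    by rewrite /= mul1r.
  by apply: eB; rewrite -ball_normE/= yn; lra.
by move=> [[x z] sx /= <-]; exists x.
Qed.

(** Above: both sides of a piece are at most 2 / 2^(m+1), so diameters are at most 2 / 2^m. Below:
    the projection contains [0, 1]. *)
Lemma hausdorff_dim_omega1 : hausdorff_dim (msupport (omega 1)) = 1%E.
Proof.
apply: hausdorff_dim1 => s s1; last first.
  by apply: hausdorff_measure_neq0 => //; exact: msupport_omega1_snd.
apply: (hausdorff_msupport_eq0 _ _ id) => //; first exact: lt_trans s1.
  move=> m; rewrite mul1r -mulrDr ler_pM2l// /xweight /yweight.
  apply: (@le_trans _ _ ((2 ^+ m.+1)^-1 + (2 ^+ m.+1)^-1)).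
    by rewrite lerD2r lef_pV2 ?posrE ?exprn_gt0// ler_eXn2l ?ltr1n//; nia.
  rewrite exprS invfM; lra.
exact: slow_decay.
Qed.

End atoms.

(** * The kernel and its velocity *)

Section kernel.
Context {R : realType}.

(* A continuous extension of [xdig n |-> ydig n]. *)
Definition digit_transfer (x : R) : R :=
  2^-1 * Rintegral geom_measure setT (fun i => digit_wave (2 ^+ (i.+1 ^ 2) * x)).

(** The factor 1/2 turns the weights 2^-i of [geom_measure] into the weights 2^-(i+1) of [ydig]. *)
Lemma digit_transfer_xdig n : digit_transfer (xdig n) = ydig n.
Proof.
rewrite /digit_transfer (Rintegral_geom_measure _ n); last first.
  by move=> i ni; rewrite digit_wave_xdig bit_ge.
rewrite /ydig /digit_sum mulr_sumr; apply: eq_bigr => i _.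
by rewrite digit_wave_xdig mulrA -exprS exprVn mulrC.
Qed.

Lemma continuous_digit_transfer : continuous digit_transfer.
Proof.
move=> x; apply: cvgMl_tmp.
apply: (@continuous_Rintegral_geom _ (fun x i => digit_wave (2 ^+ (i.+1 ^ 2) * x)) 1).
  by move=> y n; exact: norm_clamp01.
move=> n y; apply: (cvg_comp (fun y => 2 ^+ (n.+1 ^ 2) * y) digit_wave).
  by apply: cvgMl_tmp; exact: cvg_id.
exact: continuous_digit_wave.
Qed.

(** The first factor is 0 for z <= 1 and 1 for z >= 2. The shift by 2 matches the resting atom at
    -2, seen from x_n at z = x_n + 2. The outer clamp bounds the kernel and fixes the values y_n in
    [0, 1]. *)
Definition kernel1 (z : R) : R := clamp01 (z - 1) * clamp01 (digit_transfer (z - 2)).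

Definition shear_kernel (z : R * R) : R * R := (0, kernel1 z.1).

Lemma norm_kernel1 z : `|kernel1 z| <= 1.
Proof. by rewrite normrM mulr_ile1// norm_clamp01. Qed.

Lemma kernel1_eq0 z : z <= 1 -> kernel1 z = 0.
Proof. by move=> z1; rewrite /kernel1 clamp01_le0 ?mul0r// subr_le0. Qed.

Lemma continuous_kernel1 : continuous kernel1.
Proof.
move=> z; apply: cvgM.
  apply: (cvg_comp (fun z => z - 1) clamp01); last exact: continuous_clamp01.
  by apply: cvgB; [exact: cvg_id|exact: cvg_cst].
apply: (cvg_comp (fun z => digit_transfer (z - 2)) clamp01); last exact: continuous_clamp01.
apply: (cvg_comp (fun z => z - 2) digit_transfer); last exact: continuous_digit_transfer.
by apply: cvgB; [exact: cvg_id|exact: cvg_cst].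
Qed.

Lemma continuous_pair {T U V : topologicalType} (f : T -> U) (g : T -> V) :
  continuous f -> continuous g -> continuous (fun x => (f x, g x)).
Proof.
move=> cf cg x.
exact: (@cvg_pair _ _ _ (nbhs x) (nbhs (f x)) (nbhs (g x)) _ _ _ f g (cf x) (cg x)).
Qed.

Lemma continuous_shear_kernel : continuous shear_kernel.
Proof.
apply: continuous_pair => z; first exact: cvg_cst.
apply: (cvg_comp fst kernel1); [exact: cvg_fst|exact: continuous_kernel1].
Qed.

Definition shear (a : R) : R :=
  Rintegral geom_measure setT (fun n => kernel1 (a - atomX n)).

Lemma continuous_shear : continuous shear.
Proof.
apply: (@continuous_Rintegral_geom _ (fun a n => kernel1 (a - atomX n)) 1).
  by move=> a n; exact: norm_kernel1.
move=> n a; apply: (cvg_comp (fun a => a - atomX n) kernel1).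
  by apply: cvgB; [exact: cvg_id|exact: cvg_cst].
exact: continuous_kernel1.
Qed.

(** The equation of motion: each atom's vertical speed is the velocity at its position. Sources of
    positive index lie at x_i >= 0 and the target at most at 1, so the difference is at most 1 and
    only the resting atom acts. *)
Lemma shear_atom n : shear (atomX n) = atomY n.
Proof.
rewrite /shear (Rintegral_geom_measure _ 1); last first.
  case=> // i _; apply: kernel1_eq0; have /andP[x0 x1] := @xdig_itv R i.
  case: n => [|n] /=; first lra.
  by have /andP[? ?] := @xdig_itv R n; lra.
rewrite big_ord1 expr0 mul1r /= opprK.
case: n => [|n] /=; first by rewrite kernel1_eq0//; lra.
have /andP[x0 x1] := @xdig_itv R n.
rewrite /kernel1 clamp01_ge1 ?mul1r; last by lra.
by rewrite addrK digit_transfer_xdig clamp01_id// ydig_itv.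
Qed.

Lemma measurable_kernel_shift (x : R * R) :
  measurable_fun setT (fun y : R * R => kernel1 (x.1 - y.1)).
Proof.
apply: continuous_measurable2 => y.
apply: (cvg_comp (fun y : R * R => x.1 - y.1) kernel1); last exact: continuous_kernel1.
by apply: cvgB; [exact: cvg_cst|exact: cvg_fst].
Qed.

Lemma kernel_integrable t (x : R * R) :
  (omega t).-integrable setT (EFin \o (fun y => (shear_kernel (x.1 - y.1, x.2 - y.2)).1)) /\
  (omega t).-integrable setT (EFin \o (fun y => (shear_kernel (x.1 - y.1, x.2 - y.2)).2)).
Proof.
split; apply: (@omega_integrable _ _ _ 1) => //=.
- by move=> n; rewrite normr0.
- exact: measurable_kernel_shift.
- by move=> n; exact: norm_kernel1.
Qed.

Lemma velocityE t x : velocity shear_kernel omega t x = (0, shear x.1).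
Proof.
rewrite /velocity; congr (_, _); first by rewrite /Rintegral integral0.
apply: (@Rintegral_omega _ _ _ 1) => [|n]; first exact: measurable_kernel_shift.
exact: norm_kernel1.
Qed.

Lemma continuous_velocity :
  continuous (fun p : R * (R * R) => velocity shear_kernel omega p.1 p.2).
Proof.
rewrite (_ : (fun _ => _) = fun p : R * (R * R) => (0, shear p.2.1)).
  apply: continuous_pair => p; first exact: cvg_cst.
  apply: (cvg_comp (fun p : R * (R * R) => p.2.1) shear); last exact: continuous_shear.
  apply: (cvg_comp snd fst); [exact: cvg_snd|exact: cvg_fst].
by apply/funext => q; rewrite velocityE.
Qed.

End kernel.

(** * Incompressibility *)

Section compact_support.
Context {R : realType}.

Lemma compact_image_bounded {T : topologicalType} (S : set T) (g : T -> R) :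
  compact S -> continuous g -> exists M, forall x, S x -> `|g x| <= M.
Proof.
move=> cS cg.
have : compact (g @` S) by apply: continuous_compact => //; exact: continuous_subspaceT.
move=> /compact_bounded[M [_ HM]]; exists (M + 1) => x Sx.
by apply: (HM (M + 1)); [rewrite ltrDl|exists x].
Qed.

Lemma compact_support_bounded {T : topologicalType} (S : set T) (g : T -> R) :
  compact S -> continuous g -> (forall x, ~ S x -> g x = 0) ->
  exists M, forall x, `|g x| <= M.
Proof.
move=> cS cg g0; have [M HM] := compact_image_bounded _ _ cS cg.
exists `|M| => x; have [Sx|nSx] := pselect (S x).
  by apply: le_trans (HM x Sx) (ler_norm _).
by rewrite g0// normr0.
Qed.

Lemma derive1_near0 (f : R -> R) (a : R) : (\forall s \near a, f s = 0) -> derive1 f a = 0.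
Proof.
move=> f0; rewrite derive1E (@near_eq_derive _ _ _ f (cst 0))//.
exact: derive_cst.
Qed.

(** Here [c] is a line parallel to an axis: off the closed support a slice vanishes near the point,
    and so do the partial derivatives there. *)
Lemma near_support0 {T : topologicalType} (g : T -> R) (c : R -> T) (a : R) :
  continuous c -> ~ closure [set x | g x != 0] (c a) ->
  \forall s \near a, g (c s) = 0.
Proof.
move=> cc nS.
have : nbhs (c a) (~` closure [set x | g x != 0]).
  by apply: open_nbhs_nbhs; split => //; apply: closed_openC; exact: closed_closure.
move=> /cc; rewrite nbhs_simpl/=; apply: filterS => s /= ns; apply: contrapT => gs.
by apply: ns; apply: subset_closure; apply/eqP.
Qed.

Lemma continuous_slice2 i (p : R * R) :
  continuous (fun s : R => if i then (s, p.2) else (p.1, s)).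
Proof.
by case: i; apply: continuous_pair => s; do ?[exact: cvg_id|exact: cvg_cst].
Qed.

Lemma pd2_support (g : R * R -> R) i p : ~ closure [set x | g x != 0] p -> pd2 i g p = 0.
Proof.
move=> np; rewrite /pd2; apply: derive1_near0.
have : ~ closure [set x | g x != 0] (if i then (coord2 i p, p.2) else (p.1, coord2 i p)).
  by case: i; case: p np.
move=> /(near_support0 _ _ _ (continuous_slice2 i p)).
by case: i.
Qed.

Lemma leb2_box_integrable (f : R * R -> R) (N M : R) : measurable_fun setT f ->
  (forall p, `|f p| <= M) -> (forall p, ~ (`[- N, N] `*` `[- N, N]) p -> f p = 0) ->
  (@leb2 R).-integrable setT (EFin \o f).
Proof.
move=> mf fM f0; pose D : set (R * R) := `[- N, N]%classic `*` `[- N, N]%classic.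
have mD : measurable D by apply: measurableX; exact: measurable_itv.
have E : EFin \o f = (EFin \o f) \_ D.
  apply/funext => p; rewrite patchE; case: ifPn => //; rewrite notin_setE => /f0 /=.
  by move=> ->.
have mI : measurable (`[- N, N]%classic : set R) by exact: measurable_itv.
have LD : (leb2 D < +oo)%E.
  have -> : leb2 D = (lebesgue_measure (`[(- N)%R, N]%classic : set R) *
      lebesgue_measure (`[(- N)%R, N]%classic : set R))%E.
    exact: (product_measure1E lebesgue_measure lebesgue_measure mI mI).
  rewrite lebesgue_measure_itv/= lte_fin.
  by case: ifPn => _; rewrite ?mule0 ?ltry// -EFinB -EFinM ltry.
rewrite E -integrable_mkcond//.
apply: measurable_bounded_integrable => //.
- exact: measurable_funTS.
exists M; split; first exact: num_real.
by move=> x Mx n _; apply: le_trans (fM n) (ltW Mx).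
Qed.

(** By Fubini the vertical variable is integrated first. On a vertical line the shear is constant,
    so the integrand is the derivative of a multiple of [psi], which vanishes at both ends of a
    large segment. *)
Lemma weakly_div_free_shear (T : R) : weakly_div_free T (velocity shear_kernel omega : R -> _).
Proof.
move=> t t0T psi [spsi cS].
set S := closure _ in cS.
pose h := pd2 false psi.
have ch : continuous h := (spsi [:: false]).1.
have cpsi : continuous psi := (spsi [::]).1.
have h0 p : ~ S p -> h p = 0 by exact: pd2_support.
have psi0 p : ~ S p -> psi p = 0.
  by move=> nSp; apply: contrapT => /eqP pp; apply: nSp; exact: subset_closure.
have E x : transport (velocity shear_kernel omega t x) psi x = shear x.1 * h x.
  by rewrite velocityE /transport/= mul0r add0r.
have -> : (fun x => transport (velocity shear_kernel omega t x) psi x) =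
  (fun x => shear x.1 * h x) by apply/funext => x.
have cf : continuous (fun x : R * R => shear x.1 * h x).
  move=> x; apply: cvgM; last exact: ch.
  by apply: (cvg_comp fst shear); [exact: cvg_fst|exact: continuous_shear].
have [M HM] : exists M, forall x : R * R, `|shear x.1 * h x| <= M.
  by apply: compact_support_bounded cS cf _ => x nSx; rewrite h0// mulr0.
have [N1 HN1] := compact_image_bounded _ _ cS (fun x => @cvg_fst _ _ _ _ _).
have [N2 HN2] := compact_image_bounded _ _ cS (fun x => @cvg_snd _ _ _ _ _).
(* The summand 1 puts the support strictly inside the box, so that [psi] is 0 at the endpoints -N
   and N. *)
pose N := `|N1| + `|N2| + 1.
have N0 : 0 < N by rewrite ltr_wpDl// addr_ge0.
have SN p : S p -> - N < p.1 < N /\ - N < p.2 < N.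
  move=> Sp; split; rewrite -ltr_norml.
    apply: le_lt_trans (HN1 p Sp) _; apply: le_lt_trans (ler_norm _) _.
    by rewrite /N -addrA ltrDl ltr_wpDl.
  apply: le_lt_trans (HN2 p Sp) _; apply: le_lt_trans (ler_norm _) _.
  by rewrite /N addrAC ltrDr ltr_wpDl.
have fint : (@leb2 R).-integrable setT (EFin \o (fun x => shear x.1 * h x)).
  apply: (@leb2_box_integrable _ N M) => //; first exact: continuous_measurable2.
  move=> p np; rewrite h0 ?mulr0// => /SN[/andP[? ?] /andP[? ?]]; apply: np.
  by split => /=; rewrite in_itv/= !ltW.
split; first exact: fint.
rewrite /Rintegral -(integral12_prod_meas1 fint) integral0_eq//= => x _.
rewrite /fubini_F/=.
pose f1 (y : R) : \bar R := (shear x * h (x, y))%:E.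
have -> : integral lebesgue_measure setT f1 =
    integral lebesgue_measure `[- N, N]%classic f1.
  rewrite [RHS]integral_mkcond; congr integral; apply/funext => y.
  rewrite patchE; case: ifPn => //; rewrite notin_setE/= in_itv/= => ny.
  by rewrite /f1 h0 ?mulr0// => /SN[_ /= /andP[? ?]]; apply: ny; rewrite !ltW.
have cs (g : R * R -> R) : continuous g -> continuous (fun y => g (x, y)).
  move=> cg y; apply: (cvg_comp (fun y => (x, y)) g); last exact: cg.
  by apply: (continuous_pair (fun=> x) id) => z; [exact: cvg_cst|exact: cvg_id].
pose F := fun y => shear x * psi (x, y).
have dF (y : R) : is_derive y 1 F (shear x * h (x, y)).
  apply: (@is_deriveZ _ _ _ (fun y => psi (x, y)) (shear x) y 1).
  rewrite /h/pd2 derive1E; apply/derivableP; exact: ((spsi [::]).2 false (x, y)).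
have cF : continuous F.
  by move=> y; apply: cvgMl_tmp; exact: (cs psi cpsi).
rewrite (@continuous_FTC2 _ _ F).
- by rewrite /F !psi0 ?mulr0 ?subee// => /SN[_ /=]; lra.
- by lra.
- by apply: continuous_subspaceT => y; apply: cvgMl_tmp; exact: (cs h ch).
- split; first by move=> y _; have := dF y => ?; exact: ex_derive.
  + by apply: cvg_at_right_filter; exact: cF.
  + by apply: cvg_at_left_filter; exact: cF.
- by move=> y _; rewrite derive1E; exact: derive_val.
Qed.

End compact_support.

(** * Advection *)

Section advection.
Context {R : realType}.

Lemma mean_value (f df : R -> R) (a b : R) :
  (forall x : R, is_derive x 1 f (df x)) ->
  exists2 c, `|c - a| <= `|b - a| & f b - f a = df c * (b - a).
Proof.
move=> dff; have cf : continuous f.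
  move=> x; apply: differentiable_continuous; apply/derivable1_diffP.
  by have := dff x => ?; exact: ex_derive.
have H u v : u <= v -> exists2 c, u <= c <= v & f v - f u = df c * (v - u).
  move=> uv; have [c] := MVT_segment uv (fun x _ => dff x) (continuous_subspaceT cf).
  by rewrite in_itv/= => cuv E; exists c.
have [ab|/ltW ba] := leP a b.
  have [c /andP[c1 c2] E] := H a b ab; exists c => //.
  by rewrite !ger0_norm; lra.
have [c /andP[c1 c2] E] := H b a ba; exists c.
  by rewrite !ler0_norm; lra.
by rewrite -opprB E; ring.
Qed.

(** A chain rule from partial derivatives alone. The increment in the first variable, [D], is
    treated by the mean value theorem and the continuity of [G1]; what remains is a chain rule in
    one variable. *)
Lemma is_derive_along_ray (G G1 G2 : R -> R -> R) (Y t : R) :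
  (forall s y : R, is_derive s 1 (G ^~ y) (G1 s y)) ->
  (forall s y : R, is_derive y 1 (G s) (G2 s y)) ->
  continuous (fun p : R * R => G1 p.1 p.2) ->
  is_derive t 1 (fun s => G s (s * Y)) (G1 t (t * Y) + Y * G2 t (t * Y)).
Proof.
move=> dG1 dG2 cG1.
pose D s := G s (s * Y) - G t (s * Y).
have dD : is_derive t 1 D (G1 t (t * Y)).
  have cvgD : h^-1 *: (D (h *: 1 + t) - D t) @[h --> 0^'] --> G1 t (t * Y).
    apply/cvgrPdist_le => /= eps eps0.
    have /cvgrPdist_le /(_ eps eps0) := cG1 (t, t * Y).
    move=> /nbhs_ballP[d /= d0 dB].
    (* This radius makes both |h| and |h Y| smaller than d. *)
    pose r := d / (1 + `|Y|).
    have Y0 : 0 < 1 + `|Y| by rewrite ltr_pwDl.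
    have r0 : 0 < r by rewrite divr_gt0.
    exists r => //= h; rewrite /ball_/= sub0r normrN => hr hN0.
    have [c cb E] := mean_value (G ^~ ((h + t) * Y)) (G1 ^~ ((h + t) * Y)) t (h + t)
      (fun x => dG1 x _).
    rewrite /D subrr subr0 /GRing.scale/= mulr1 E addrK mulrCA mulVf// mulr1.
    apply: (dB (c, (h + t) * Y)); split => /=; rewrite -ball_normE/=.
      rewrite distrC; apply: le_lt_trans cb _; rewrite addrK; apply: lt_le_trans hr _.
      by rewrite ler_pdivrMr// mulrDr mulr1 lerDl mulr_ge0// ltW.
    rewrite mulrDl opprD addrCA subrr addr0 normrN normrM.
    apply: (@le_lt_trans _ _ (`|h| * (1 + `|Y|))).
      by rewrite ler_wpM2l// lerDr.
    by rewrite -ltr_pdivlMr.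
  apply: DeriveDef; first by apply/cvg_ex; exists (G1 t (t * Y)).
  exact/cvg_lim.
have dE : is_derive t 1 (fun s => G t (s * Y)) (Y * G2 t (t * Y)).
  have dl : is_derive t 1 (fun s : R => s * Y) Y.
    rewrite (_ : (fun s => s * Y) = Y \*: id); last first.
      by apply/funext => s; rewrite /= mulrC.
    by rewrite -[X in is_derive _ _ _ X]mulr1; apply: is_deriveZ.
  rewrite mulrC; exact: (@is_derive1_comp _ (G t) (fun s => s * Y) t _ _ (dG2 t _) dl).
rewrite (_ : (fun s => G s (s * Y)) = D \+ (fun s => G t (s * Y))).
  exact: is_deriveD.
by apply/funext => s; rewrite /D /= subrK.
Qed.

Lemma continuous_slice3 i (p : R * (R * R)) :
  continuous (fun s : R => match i with
    | None => (s, p.2)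
    | Some true => (p.1, (s, p.2.2))
    | Some false => (p.1, (p.2.1, s)) end).
Proof.
case: i => [[]|].
- apply: (continuous_pair (fun=> p.1) (fun s => (s, p.2.2))); first by move=> ?; exact: cvg_cst.
  by apply: (continuous_pair id (fun=> p.2.2)) => s; [exact: cvg_id|exact: cvg_cst].
- apply: (continuous_pair (fun=> p.1) (fun s => (p.2.1, s))); first by move=> ?; exact: cvg_cst.
  by apply: (continuous_pair (fun=> p.2.1) id) => s; [exact: cvg_cst|exact: cvg_id].
by apply: (continuous_pair id (fun=> p.2)) => s; [exact: cvg_id|exact: cvg_cst].
Qed.

Lemma pd3_support (g : R * (R * R) -> R) i p :
  ~ closure [set x | g x != 0] p -> pd3 i g p = 0.
Proof.
move=> np; rewrite /pd3; apply: derive1_near0.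
have := near_support0 g _ (coord3 i p) (continuous_slice3 i p).
by case: i => [[]|]; apply; case: p np => ? [].
Qed.

Lemma continuous_atom_path (h : R * (R * R) -> R) n :
  continuous h -> continuous (fun t => h (t, atom t n)).
Proof.
have ca : continuous (fun t : R => atom t n).
  apply: (@continuous_pair R R R (fun=> atomX n) (fun t => t * atomY n)) => t; first exact: cvg_cst.
  by apply: cvgMr_tmp; exact: cvg_id.
move=> ch t; apply: (cvg_comp (fun t => (t, atom t n)) h); last exact: ch.
by apply: (continuous_pair id (atom ^~ n)) => s; [exact: cvg_id|exact: ca].
Qed.

Lemma continuous_at_time (h : R * (R * R) -> R) (t : R) :
  continuous h -> continuous (fun x => h (t, x)).
Proof.
move=> ch x; apply: (cvg_comp (fun x => (t, x)) h); last exact: ch.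
by apply: (continuous_pair (fun=> t) id) => s; [exact: cvg_cst|exact: cvg_id].
Qed.

(** The integral of phi(t) against omega(t) is a sum over atoms, differentiable term by term along
    their paths. As each atom moves with the flow, the derivative is the sum of the two integrands
    of the weak form, which thus is the fundamental theorem of calculus. *)
Lemma weakly_advected_shear (T : R) : 0 < T ->
  weakly_advected T (velocity shear_kernel omega) (omega : R -> _).
Proof.
move=> T0 phi [sg cS]; cbv zeta; pose g (p : R * (R * R)) := phi p.1 p.2.
pose g0 := pd3 None g; pose g2 := pd3 (Some false) g.
rewrite -/g in sg cS; have cg : continuous g := (sg [::]).1.
have cg0 : continuous g0 := (sg [:: None]).1.
have cg2 : continuous g2 := (sg [:: Some false]).1.
have [M HM] : exists M, forall p, `|g p| <= M.
  apply: compact_support_bounded cS cg _ => p nSp.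
  by apply: contrapT => /eqP gp; apply: nSp; exact: subset_closure.
have [M0 HM0] : exists M, forall p, `|g0 p| <= M.
  by apply: compact_support_bounded cS cg0 _ => p; exact: pd3_support.
have [M2 HM2] : exists M, forall p, `|g2 p| <= M.
  by apply: compact_support_bounded cS cg2 _ => p; exact: pd3_support.
have E2 t x : transport (velocity shear_kernel omega t x) (phi t) x =
    shear x.1 * g2 (t, x).
  by rewrite velocityE /transport/= mul0r add0r.
have HY n c : `|c| <= M2 -> `|atomY n * c| <= M2.
  move=> cM; have /andP[y0 y1] := @atomY_itv R n.
  by rewrite normrM (ger0_norm y0) (le_trans _ cM)// ler_piMl.
have ms t : measurable_fun setT (fun x : R * R => shear x.1 * g2 (t, x)).
  apply: continuous_measurable2 => x; apply: cvgM; last exact: (continuous_at_time g2 t cg2).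
  by apply: (cvg_comp fst shear); [exact: cvg_fst|exact: continuous_shear].
(* At an atom the shear equals [atomY n], a number in [0, 1], so the bound [M2] persists. *)
have HB t n : `|shear (atom t n).1 * g2 (t, atom t n)| <= M2.
  by rewrite shear_atom; exact: HY.
pose A t := Rintegral geom_measure setT (fun n => g0 (t, atom t n)).
pose B t := Rintegral geom_measure setT (fun n => atomY n * g2 (t, atom t n)).
pose P t := Rintegral geom_measure setT (fun n => g (t, atom t n)).
have AE t : Rintegral (omega t) setT (fun x => g0 (t, x)) = A t.
  apply: (@Rintegral_omega _ _ _ M0) => [|n]; last exact: HM0.
  exact: continuous_measurable2 (continuous_at_time g0 t cg0).
have BE t : Rintegral (omega t) setT
    (fun x => transport (velocity shear_kernel omega t x) (phi t) x) = B t.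
  rewrite (_ : (fun x => _) = (fun x => shear x.1 * g2 (t, x))); last first.
    by apply/funext => x; rewrite E2.
  rewrite (@Rintegral_omega _ _ _ M2)//; congr Rintegral; apply/funext => n.
  by rewrite /= shear_atom.
have PE t : Rintegral (omega t) setT (phi t) = P t.
  apply: (@Rintegral_omega _ _ (fun x => g (t, x)) M) => [|n]; last exact: HM.
  exact: continuous_measurable2 (continuous_at_time g t cg).
have cA : continuous A.
  apply: (@continuous_Rintegral_geom _ (fun t n => g0 (t, atom t n)) M0) => [t n|n].
    exact: HM0.
  exact: continuous_atom_path.
have cB : continuous B.
  apply: (@continuous_Rintegral_geom _ (fun t n => atomY n * g2 (t, atom t n)) M2) => [t n|n].
    exact/HY.
  by move=> t; apply: cvgMl_tmp; exact: (continuous_atom_path g2 n cg2).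
have dP (t : R) : is_derive t 1 P (A t + B t).
  have -> : A t + B t =
      Rintegral geom_measure setT (fun n => g0 (t, atom t n) + atomY n * g2 (t, atom t n)).
    rewrite RintegralD//.
      by apply: geom_measure_integrable => n; exact: HM0.
    by apply: geom_measure_integrable => n; exact/HY.
  apply: (@is_derive_Rintegral_geom _ (fun t n => g (t, atom t n))
    (fun t n => g0 (t, atom t n) + atomY n * g2 (t, atom t n)) M (M0 + M2)) => [s n|s n|n s].
  - exact: HM.
  - by apply: le_trans (ler_normD _ _) _; rewrite lerD//; exact/HY.
  (* The path of an atom is vertical with height s y, a ray in the plane of time and height; the
     horizontal position is a parameter. *)
  apply: (is_derive_along_ray (fun s y => g (s, (atomX n, y)))
    (fun s y => g0 (s, (atomX n, y))) (fun s y => g2 (s, (atomX n, y)))).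
  - move=> r y; rewrite /g0 /pd3 derive1E; apply/derivableP.
    exact: ((sg [::]).2 None (r, (atomX n, y))).
  - move=> r y; rewrite /g2 /pd3 derive1E; apply/derivableP.
    exact: ((sg [::]).2 (Some false) (r, (atomX n, y))).
  - move=> p; apply: (cvg_comp (fun p => (p.1, (atomX n, p.2))) g0); last exact: cg0.
    apply: (continuous_pair fst (fun p => (atomX n, p.2))) => q; first exact: cvg_fst.
    by apply: (@continuous_pair (R * R)%type R R (fun=> atomX n) snd) => q'; [exact: cvg_cst|exact: cvg_snd].
have cP : continuous P.
  move=> x; apply: differentiable_continuous; apply/derivable1_diffP.
  by have := dP x => ?; exact: ex_derive.
have IT : interval0T T = `[0, T]%classic.
  by apply/seteqP; split => t; rewrite /interval0T/= in_itv.
have iA : lebesgue_measure.-integrable (interval0T T) (EFin \o A).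
  rewrite IT; apply: continuous_compact_integrable; first exact: segment_compact.
  exact: continuous_subspaceT.
have iB : lebesgue_measure.-integrable (interval0T T) (EFin \o B).
  rewrite IT; apply: continuous_compact_integrable; first exact: segment_compact.
  exact: continuous_subspaceT.
split=> [t _|].
  split; last split.
  - apply: (@omega_integrable _ _ _ M0) => [|n]; last exact: (HM0 (t, atom t n)).
    exact: (continuous_measurable2 _ (continuous_at_time g0 t cg0)).
  - rewrite (_ : _ \o _ = EFin \o (fun x => shear x.1 * g2 (t, x))); last first.
      by apply/funext => x; rewrite /= E2.
    exact: (@omega_integrable _ _ _ M2).
  - apply: (@omega_integrable _ _ _ M) => [|n]; last exact: (HM (t, atom t n)).
    exact: (continuous_measurable2 _ (continuous_at_time g t cg)).
have -> : (fun t => Rintegral (omega t) setT (fun x => derive1 (phi ^~ x) t)) = A.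
  by apply/funext => t; rewrite -AE.
have -> : (fun t => Rintegral (omega t) setT
    (fun x => transport (velocity shear_kernel omega t x) (phi t) x)) = B.
  exact/funext.
split; first exact: iA.
split; first exact: iB.
rewrite !PE.
have : Rintegral lebesgue_measure (interval0T T) (fun t => A t + B t) = P T - P 0.
  rewrite /Rintegral IT (@continuous_FTC2 _ _ P)//.
  - by apply: continuous_subspaceT => t; apply: cvgD; [exact: cA|exact: cB].
  - split; first by move=> y _; have := dP y => ?; exact: ex_derive.
    + by apply: cvg_at_right_filter; exact: cP.
    + by apply: cvg_at_left_filter; exact: cP.
  - by move=> y _; rewrite derive1E; exact: derive_val.
rewrite RintegralD//; last by rewrite IT; exact: measurable_itv.
by lra.
Qed.

End advection.

Theorem theorem3 (R : realType) :
  exists (K : R * R -> R * R) (T : R)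
         (omega : R -> {measure set (R * R) -> \bar R}),
    continuous K /\ 0 < T /\
    (* omega(t) is a finite Borel measure for t in [0,T] *)
    (forall t, 0 <= t <= T -> (omega t setT < +oo)%E) /\
    (* the integral defining u(t,x) exists *)
    (forall t, 0 <= t <= T -> forall x : R * R,
       (omega t).-integrable setT
          (EFin \o (fun y => (K (x.1 - y.1, x.2 - y.2)).1)) /\
       (omega t).-integrable setT
          (EFin \o (fun y => (K (x.1 - y.1, x.2 - y.2)).2))) /\
    (* u is continuous on [0,T] x R^2 *)
    {within [set p : R * (R * R) | 0 <= p.1 <= T],
       continuous (fun p => velocity K omega p.1 p.2)} /\
    weakly_div_free T (velocity K omega) /\
    weakly_advected T (velocity K omega) omega /\
    hausdorff_dim (msupport (omega 0)) = 0%E /\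
    hausdorff_dim (msupport (omega T)) = 1%E.
Proof.
(* At time 1 the atom heights t y_n are exactly the y_n. *)
exists shear_kernel, 1, omega.
split; first exact: continuous_shear_kernel.
split; first exact: ltr01.
split; first by move=> t _; exact: omegaT.
split; first by move=> t _ x; exact: kernel_integrable.
split; first exact: continuous_subspaceT continuous_velocity.
split; first exact: weakly_div_free_shear.
split; first exact: weakly_advected_shear ltr01.
by split; [exact: hausdorff_dim_omega0|exact: hausdorff_dim_omega1].
Qed.
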